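(* Let $n\ge2$, let $K$ be the Cauchy--Szegő kernel on the quaternionic Heisenberg group $\mathscr H^{n-1}$, let $K(g,h)=K(h^{-1}\cdot g)$ for $g\ne h$, let $\rho$ be the quasi-distance $\rho(h,g)=\|g^{-1}\cdot h\|$, and let $Q=4n+2$. Then for every $j=1,\dots,4n-4$, $$|Y_jK(g)|\lesssim\frac1{\rho(g,\mathbf 0)^{Q+1}},\qquad g\in\mathscr H^{n-1}\setminus\{\mathbf 0\}.$$ Moreover, there is a constant $c>0$ such that the kernel $K(g,h)$ ($g\neq h$) satisfies: (i) $|K(g,h)|\lesssim \dfrac{1}{\rho(g,h)^{Q}}$; (ii) $|K(g,h)-K(g_0,h)|\lesssim\dfrac{\rho(g,g_0)}{\rho(g_0,h)^{Q+1}}$ if $\rho(g_0,h)\ge c\,\rho(g,g_0)$; (iii) $|K(g,h)-K(g,h_0)|\lesssim\dfrac{\rho(h,h_0)}{\rho(g,h_0)^{Q+1}}$ if $\rho(g,h_0)\ge c\,\rho(h,h_0)$. Here $A\lesssim B$ means $A\le CB$ with a constant $C$ independent of the points $g,h,g_0,h_0$, and in (i)--(iii) all kernel values are taken at pairs of distinct points.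
   Context: $\mathbb H$ denotes the quaternions with the usual conjugate, modulus and imaginary part. The quaternionic Heisenberg group $\mathscr H^{n-1}$ is $\operatorname{Im}\mathbb H\times\mathbb H^{n-1}\cong\mathbb R^3\times\mathbb R^{4(n-1)}$ with product $$(t,y)\cdot(t',y')=\big(t+t'+2\operatorname{Im}\langle y,y'\rangle,\;y+y'\big),\qquad \langle y,y'\rangle=\sum_{l=1}^{n-1}\overline{y}_l\,y'_l,$$ where $t=t_1\mathbf i+t_2\mathbf j+t_3\mathbf k$. The neutral element is $\mathbf 0=(0,0)$, and $(t,y)^{-1}=(-t,-y)$. The homogeneous norm is $\|(t,y)\|=(|y|^4+t_1^2+t_2^2+t_3^2)^{1/4}$, and $\rho(h,g)=\|g^{-1}\cdot h\|$. $Q=4n+2$ is the homogeneous dimension. Write $y=(y_1,\dots,y_{4n-4})$ in real coordinates, the quaternionic coordinates being $y_{4l+1}+y_{4l+2}\mathbf i+y_{4l+3}\mathbf j+y_{4l+4}\mathbf k$, $l=0,\dots,n-2$. The left-invariant vector fields are $$Y_{4l+j}=\frac{\partial}{\partial y_{4l+j}}+2\sum_{\alpha=1}^3\sum_{k=1}^4b^\alpha_{kj}\,y_{4l+k}\frac{\partial}{\partial t_\alpha},\qquad l=0,\dots,n-2,\ j=1,\dots,4,$$ where $b^\alpha_{kj}$ are the $(k,j)$ entries of $$b^1=\begin{pmatrix}0&1&0&0\\-1&0&0&0\\0&0&0&-1\\0&0&1&0\end{pmatrix},\quad b^2=\begin{pmatrix}0&0&1&0\\0&0&0&1\\-1&0&0&0\\0&-1&0&0\end{pmatrix},\quad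 b^3=\begin{pmatrix}0&0&0&1\\0&0&-1&0\\0&1&0&0\\-1&0&0&0\end{pmatrix}.$$ The Cauchy--Szegő kernel on $\mathscr H^{n-1}$ is the $\mathbb H$-valued function $$K(g)=s(|y|^2+t),\quad g=(t,y)\neq\mathbf 0,\qquad s(\sigma)=c_{n-1}\frac{\partial^{2(n-1)}}{\partial x_1^{2(n-1)}}\frac{\overline\sigma}{|\sigma|^4},\quad \sigma=x_1+x_2\mathbf i+x_3\mathbf j+x_4\mathbf k\ne0,$$ where $c_{n-1}$ is a real constant depending only on $n$ (the normalizing constant of the Cauchy--Szegő kernel of the quaternionic Siegel upper half-space). Vector fields act componentwise on $\mathbb H$-valued functions. *)

(* Defs.v *)
From mathcomp Require Import all_boot all_order all_algebra.
From mathcomp Require Import all_classical all_reals all_analysis.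

Set Implicit Arguments.
Unset Strict Implicit.
Unset Printing Implicit Defensive.

Import Order.TTheory GRing.Theory Num.Theory.
Import numFieldNormedType.Exports.

Local Open Scope ring_scope.

(* A quaternion x1 + x2 i + x3 j + x4 k is the row (x1, x2, x3, x4); an
   imaginary one t1 i + t2 j + t3 k is the row (t1, t2, t3).  The library norm
   `|_| on rows is the sup norm: the quaternionic modulus is [qabs]. *)
Notation quat R := 'rV[R]_4.
Notation imquat R := 'rV[R]_3.

Definition mkquat (R : realType) (x1 x2 x3 x4 : R) : quat R :=
  \row_(i < 4) [:: x1; x2; x3; x4]`_i.

Definition quat_of_re_im (R : realType) (x : R) (t : imquat R) : quat R :=
  mkquat x (t 0 (inord 0)) (t 0 (inord 1)) (t 0 (inord 2)).

Definition q1 (R : realType) (p : quat R) : R := p 0 (inord 0).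
Definition q2 (R : realType) (p : quat R) : R := p 0 (inord 1).
Definition q3 (R : realType) (p : quat R) : R := p 0 (inord 2).
Definition q4 (R : realType) (p : quat R) : R := p 0 (inord 3).

Definition qim (R : realType) (p : quat R) : imquat R :=
  \row_(i < 3) [:: q2 p; q3 p; q4 p]`_i.

Definition qconj (R : realType) (p : quat R) : quat R :=
  mkquat (q1 p) (- q2 p) (- q3 p) (- q4 p).

Definition qabs (R : realType) (p : quat R) : R :=
  Num.sqrt (\sum_(i < 4) p 0 i ^+ 2).

Definition qmul (R : realType) (p q : quat R) : quat R :=
  mkquat
    (q1 p * q1 q - q2 p * q2 q - q3 p * q3 q - q4 p * q4 q)
    (q1 p * q2 q + q2 p * q1 q + q3 p * q4 q - q4 p * q3 q)
    (q1 p * q3 q - q2 p * q4 q + q3 p * q1 q + q4 p * q2 q)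
    (q1 p * q4 q + q2 p * q3 q - q3 p * q2 q + q4 p * q1 q).

(* An element of H^m is an m x 4 real matrix, row l being the quaternion y_l;
   the real coordinate with flat index 4l + j + 1 is the entry (l, j). *)
Definition qdot (R : realType) (m : nat) (y y' : 'M[R]_(m, 4)) : quat R :=
  \sum_(l < m) qmul (qconj (row l y)) (row l y').

Definition yabs (R : realType) (m : nat) (y : 'M[R]_(m, 4)) : R :=
  Num.sqrt (\sum_(l < m) qabs (row l y) ^+ 2).

(* The group H^{n-1}, with elements (t, y). *)
Definition heis (R : realType) (n : nat) := (imquat R * 'M[R]_(n.-1, 4))%type.

Section Heisenberg.
Variables (R : realType) (n : nat).
Implicit Types g h : heis R n.

Definition hzero : heis R n := (0, 0).

Definition hmul g h : heis R n :=
  (g.1 + h.1 + 2 *: qim (qdot g.2 h.2), g.2 + h.2).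

Definition hinv g : heis R n := (- g.1, - g.2).

Definition hnorm g : R :=
  (yabs g.2 ^+ 4 + \sum_(a < 3) g.1 0 a ^+ 2) `^ (4^-1).

Definition rho h g : R := hnorm (hmul (hinv g) h).

Definition homdim : nat := 4 * n + 2.

(* [bmx a] is the matrix b^(a+1); all indices are shifted to start at 0. *)
Definition bmx (a : 'I_3) : 'M[R]_4 :=
  \matrix_(k < 4, j < 4)
    (nth [::] (nth [::]
      [:: [:: [:: 0;  1;  0;  0];
              [:: -1; 0;  0;  0];
              [:: 0;  0;  0; -1];
              [:: 0;  0;  1;  0]];
          [:: [:: 0;  0;  1;  0];
              [:: 0;  0;  0;  1];
              [:: -1; 0;  0;  0];
              [:: 0; -1;  0;  0]];
          [:: [:: 0;  0;  0;  1];
              [:: 0;  0; -1;  0];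
              [:: 0;  1;  0;  0];
              [:: -1; 0;  0;  0]]] a) k)`_j.

Definition dir_t (a : 'I_3) : heis R n := (delta_mx 0 a, 0).
Definition dir_y (l : 'I_n.-1) (j : 'I_4) : heis R n := (0, delta_mx l j).

Definition Yvf (l : 'I_n.-1) (j : 'I_4) (f : heis R n -> R) g : R :=
  'D_(dir_y l j) f g
  + 2 * \sum_(a < 3) \sum_(k < 4)
          bmx a k j * g.2 l k * 'D_(dir_t a) f g.

Definition YvfH (l : 'I_n.-1) (j : 'I_4) (F : heis R n -> quat R) g : quat R :=
  \row_(i < 4) Yvf l j (fun h => F h 0 i) g.

(* 'D_v is a total operator with a junk value where the limit does not exist;
   this says that every derivative occurring in [YvfH l j F g] exists. *)
Definition YvfH_exists (l : 'I_n.-1) (j : 'I_4) (F : heis R n -> quat R) g :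
    Prop :=
  forall i : 'I_4,
    derivable (fun h => F h 0 i) g (dir_y l j) /\
    forall a : 'I_3, derivable (fun h => F h 0 i) g (dir_t a).

(* [cn] is the real normalizing constant c_{n-1}. *)
Definition szego_s (cn : R) (sigma : quat R) : quat R :=
  \row_(i < 4)
    (cn * derive1n (2 * n.-1)
            (fun x1 : R =>
               let s := mkquat x1 (q2 sigma) (q3 sigma) (q4 sigma) in
               qconj s 0 i / qabs s ^+ 4) (q1 sigma)).

Definition szegoK (cn : R) g : quat R :=
  szego_s cn (quat_of_re_im (yabs g.2 ^+ 2) g.1).

Definition szegoK2 (cn : R) g h : quat R := szegoK cn (hmul (hinv h) g).

End Heisenberg.

Arguments hzero {R n}.

(* Main.v *)
(* In the Siegel coordinate sigma(g) = |y|^2 + t one has |sigma(g)| = ||g||^2,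
   and every component of s is a homogeneous rational function of sigma of
   degree -(2n+1), with denominator a power of |sigma|^2.  Such a function F of
   degree d satisfies |F| <= C |sigma|^d and, when |tau - sigma| is small
   compared with |sigma|, |F tau - F sigma| <= C |tau - sigma| |sigma|^(d-1).
   Since sigma(uv) = sigma(u) + sigma(v) + 2 <y_u, y_v>, multiplying u on either
   side by a smaller v moves sigma(u) by O(||u|| ||v||).  This gives the size
   and regularity estimates with no integration along horizontal paths; the
   bound on Y_j K is the chain rule, as the derivative of sigma along Y_j is
   O(||g||). *)

Require Import Defs.
From mathcomp Require Import all_boot all_order all_algebra.
From mathcomp Require Import all_classical all_reals all_analysis.
From mathcomp Require Import ring lra zify.

Set Implicit Arguments.
Unset Strict Implicit.
Unset Printing Implicit Defensive.

Import Order.TTheory GRing.Theory Num.Theory.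
Import numFieldNormedType.Exports.

Local Open Scope ring_scope.

(** * The quaternionic modulus and its stability under small perturbations *)

Section Modulus.
Variable R : realType.
Implicit Types s t : quat R.

Lemma qabs_ge0 s : 0 <= qabs s.
Proof. exact: sqrtr_ge0. Qed.

Lemma sqr_qabs s : qabs s ^+ 2 = \sum_(i < 4) s 0 i ^+ 2.
Proof. by rewrite sqr_sqrtr ?sumr_ge0// => i _; rewrite sqr_ge0. Qed.

Lemma coord_le_qabs s i : `|s 0 i| <= qabs s.
Proof.
rewrite -sqrtr_sqr ler_sqrt ?sumr_ge0//; last by move=> j _; rewrite sqr_ge0.
by rewrite (bigD1 i)//= lerDl sumr_ge0// => j _; rewrite sqr_ge0.
Qed.

Lemma qabs_eq0 s : (qabs s == 0) = (s == 0).
Proof.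
apply/eqP/eqP => [s0|->]; last first.
  by apply/eqP; rewrite -sqrf_eq0 sqr_qabs big1// => i _; rewrite mxE expr0n.
apply/rowP => i; rewrite mxE; apply/eqP; rewrite -normr_eq0 eq_le normr_ge0.
by rewrite -s0 coord_le_qabs.
Qed.

Lemma qabs_gt0 s : (0 < qabs s) = (s != 0).
Proof. by rewrite lt_def qabs_ge0 andbT qabs_eq0. Qed.

(** The factor 2 is the square root of the number of coordinates. With [coord_le_qabs] this lets
    every estimate below be proved coordinate by coordinate. *)
Lemma qabs_le s b : (forall i, `|s 0 i| <= b) -> qabs s <= 2 * b.
Proof.
move=> sb; have b0 : 0 <= b by apply: le_trans (sb 0).
rewrite -(ler_pXn2r (n := 2)) ?nnegrE ?qabs_ge0 ?mulr_ge0// sqr_qabs.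
have -> : (2 * b) ^+ 2 = \sum_(i < 4) b ^+ 2.
  by rewrite !big_ord_recl big_ord0; ring.
apply: ler_sum => i _; rewrite -(real_normK (num_real (s 0 i))).
by rewrite lerXn2r ?nnegrE.
Qed.

(** In each coordinate t_i^2 >= s_i^2 - 2 s_i (s_i - t_i) >= s_i^2 - |s|^2 / 8. Summing over the
    four coordinates loses only half of |s|^2; this fixes the threshold 1/16. *)
Lemma qabs_perturb s t d : (forall i, `|t 0 i - s 0 i| <= d) ->
  d <= qabs s / 16 -> qabs s ^+ 2 <= 2 * qabs t ^+ 2.
Proof.
move=> std ds; rewrite !sqr_qabs -sqr_qabs.
have d0 : 0 <= d by apply: le_trans (std 0).
have H i : s 0 i ^+ 2 - qabs s ^+ 2 / 8 <= t 0 i ^+ 2.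
  have := std i; have := coord_le_qabs s i; have := qabs_ge0 s.
  rewrite !ler_norml => q0 /andP[h1 h2] /andP[h3 h4].
  have : (s 0 i * (s 0 i - t 0 i)) <= qabs s ^+ 2 / 16.
    apply: le_trans (ler_norm _) _; rewrite normrM expr2 -mulrA.
    apply: ler_pM => //; first exact: coord_le_qabs.
    by rewrite distrC; apply: le_trans ds.
  by have := sqr_ge0 (s 0 i - t 0 i); nra.
have : \sum_(i < 4) (s 0 i ^+ 2 - qabs s ^+ 2 / 8) <= \sum_(i < 4) t 0 i ^+ 2.
  exact: ler_sum.
rewrite big_split/= -sqr_qabs sumr_const card_ord -mulr_natr.
by lra.
Qed.

Lemma perturb_neq0 s t d : s != 0 -> (forall i, `|t 0 i - s 0 i| <= d) ->
  d <= qabs s / 16 -> t != 0.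
Proof.
move=> s0 std ds; have := qabs_perturb std ds.
rewrite -qabs_gt0 lt_def qabs_ge0 andbT -sqrf_eq0; apply: contraTneq => ->.
by rewrite mulr0 -ltNge exprn_gt0// qabs_gt0.
Qed.

(** Some coordinate is nonzero at [u] and stays so nearby by continuity. This lets identities valid
    only off the origin be differentiated along curves. *)
Lemma near_curve_neq0 (gam : R -> quat R) (u : R) : gam u != 0 ->
  (forall i, derivable (fun x => gam x 0 i) u 1) -> \near u, gam u != 0.
Proof.
move=> gu0 dgam.
have [i gi0] : exists i, gam u 0 i != 0.
  apply/existsP; apply: contraNT gu0; rewrite negb_exists => /forallP g0.
  by apply/eqP/rowP => i; rewrite mxE; apply/eqP; have := g0 i; rewrite negbK.
have /derivable1_diffP/differentiable_continuous cg := dgam i.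
near=> x.
have : gam x 0 i != 0 by near: x; exact: cvgr_neq0 cg gi0.
by apply: contraNneq => ->; rewrite mxE.
Unshelve. all: by end_near. Qed.

End Modulus.

(* [hrat d F]: off the origin, F is a homogeneous rational function of degree d.
   The value at the origin, where [x^-1] is 0, is irrelevant by [hrat_eq]. *)
Inductive hrat (R : realType) : int -> (quat R -> R) -> Prop :=
| hrat_cst (c : R) : hrat 0 (fun=> c)
| hrat_zero d : hrat d (fun=> 0)
| hrat_coord i : hrat 1 (fun s => s 0 i)
| hrat_invsq : hrat (-2) (fun s => (qabs s ^+ 2)^-1)
| hrat_add d F G : hrat d F -> hrat d G -> hrat d (fun s => F s + G s)
| hrat_mul d e F G :
    hrat d F -> hrat e G -> hrat (d + e) (fun s => F s * G s)
| hrat_eq d F G : hrat d F -> (forall s, s != 0 -> F s = G s) -> hrat d G.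

(** * Growth, Lipschitz bounds and derivatives of homogeneous rational functions *)

Section HomogeneousRational.
Variable R : realType.
Implicit Types (s t : quat R) (F G : quat R -> R) (d e : int).

Lemma hrat_sum (I : finType) d (F : I -> quat R -> R) :
  (forall i, hrat d (F i)) -> hrat d (fun s => \sum_i F i s).
Proof.
move=> rF; elim: (index_enum I) => [|i r IH].
  by under eq_fun do rewrite big_nil; exact: hrat_zero.
by under eq_fun do rewrite big_cons; exact: hrat_add.
Qed.

Lemma hrat_bound d F : hrat d F ->
  exists2 C, 0 < C & forall s, s != 0 -> `|F s| <= C * qabs s ^ d.
Proof.
elim=> {d F} [c|d|i||d F G _ [C C0 hF] _ [D D0 hG]|
              d e F G _ [C C0 hF] _ [D D0 hG]|d F G _ [C C0 hF] FG].
- by exists (`|c| + 1) => [|s _]; rewrite ?ltr_wpDl// expr0z mulr1 lerDl.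
- by exists 1 => // s _; rewrite normr0 mul1r exprz_ge0 ?qabs_ge0.
- by exists 1 => // s _; rewrite mul1r expr1z coord_le_qabs.
- by exists 1 => // s _; rewrite mul1r ger0_norm ?invr_ge0 ?exprn_ge0 ?qabs_ge0.
- exists (C + D) => [|s s0]; first exact: addr_gt0.
  by rewrite mulrDl (le_trans (ler_normD _ _))// lerD ?hF ?hG.
- exists (C * D) => [|s s0]; first exact: mulr_gt0.
  rewrite normrM expfzDr ?qabs_eq0// mulrACA.
  by apply: ler_pM => //; [exact: hF | exact: hG].
- by exists C => // s s0; rewrite -FG ?hF.
Qed.

(** Induction on the construction of [F], with no mean value theorem: only 1/|s|^2 needs a
    computation, and products follow from a discrete Leibniz rule together with [hrat_bound]. *)
Lemma hrat_lipschitz d F : hrat d F ->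
  exists2 C, 0 < C & forall s t r, s != 0 ->
    (forall i, `|t 0 i - s 0 i| <= r) -> r <= qabs s / 16 ->
    `|F t - F s| <= C * (r * qabs s ^ (d - 1)).
Proof.
elim=> {d F} [c|d|i||d F G _ [C C0 hF] _ [D D0 hG]|
              d e F G rF [C C0 hF] rG [D D0 hG]|d F G _ [C C0 hF] FG].
- exists 1 => // s t r s0 str _; rewrite subrr normr0 mul1r.
  by rewrite mulr_ge0 ?exprz_ge0 ?qabs_ge0// (le_trans _ (str 0)).
- exists 1 => // s t r s0 str _; rewrite subrr normr0 mul1r.
  by rewrite mulr_ge0 ?exprz_ge0 ?qabs_ge0// (le_trans _ (str 0)).
- by exists 1 => // s t r s0 str _; rewrite subrr expr0z mulr1 mul1r.
(* 18 = 9 * 2: the 9 bounds the numerator below, and the 2 comes from |s|^2 <= 2 |t|^2, used to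
   remove |t| from the denominator. *)
- exists 18 => // s t r s0 str rs.
  have r0 : 0 <= r by apply: le_trans (str 0).
  have q0 : 0 < qabs s by rewrite qabs_gt0.
  have st := qabs_perturb str rs.
  have qt0 : 0 < qabs t by rewrite qabs_gt0 (perturb_neq0 s0 str rs).
  have -> : (qabs t ^+ 2)^-1 - (qabs s ^+ 2)^-1 =
      (qabs s ^+ 2 - qabs t ^+ 2) / (qabs t ^+ 2 * qabs s ^+ 2).
    by field; rewrite !gt_eqF.
  have num : `|qabs s ^+ 2 - qabs t ^+ 2| <= 9 * (r * qabs s).
    rewrite !sqr_qabs -sumrB (le_trans (ler_norm_sum _ _ _))//.
    (* Here 33/16 = 2 + 1/16, since |s_i + t_i| <= 2 |s| + r and r <= |s| / 16; four such terms give
       33/4 <= 9. *)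
    apply: (@le_trans _ _ (\sum_(i < 4) (33 / 16 * (r * qabs s)))); last first.
      by rewrite sumr_const card_ord -mulr_natr; nra.
    apply: ler_sum => i _; rewrite subr_sqr normrM distrC.
    rewrite mulrCA; apply: ler_pM => //.
    have -> : s 0 i + t 0 i = 2 * s 0 i + (t 0 i - s 0 i) by ring.
    apply: le_trans (ler_normD _ _) _; rewrite normrM ger0_norm//.
    by have := coord_le_qabs s i; have := str i; lra.
  have -> : qabs s ^ (-2 - 1) = qabs s / (qabs s ^+ 2 * qabs s ^+ 2).
    by rewrite (_ : -2 - 1 = -3)// -exprnN; field; rewrite gt_eqF.
  rewrite normrM normfV.
  rewrite (ger0_norm (x := _ * _ ^+ 2)) ?mulr_ge0 ?exprn_ge0 ?qabs_ge0//.
  rewrite ler_pdivrMr ?mulr_gt0 ?exprn_gt0//.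
  have -> : 18 * (r * (qabs s / (qabs s ^+ 2 * qabs s ^+ 2))) *
      (qabs t ^+ 2 * qabs s ^+ 2) =
      9 * (r * qabs s) * ((2 * qabs t ^+ 2) / qabs s ^+ 2).
    by field; rewrite gt_eqF.
  apply: le_trans num _; rewrite ler_peMr ?mulr_ge0 ?qabs_ge0//.
  by rewrite ler_pdivlMr ?mul1r ?exprn_gt0.
- exists (C + D) => [|s t r s0 str rs]; first exact: addr_gt0.
  rewrite opprD addrACA mulrDl (le_trans (ler_normD _ _))//.
  by rewrite lerD ?hF ?hG.
- have [A A0 bF] := hrat_bound rF; have [B B0 bG] := hrat_bound rG.
  exists (C * (B + D) + A * D) => [|s t r s0 str rs].
    by rewrite addr_gt0 ?mulr_gt0 ?addr_gt0.
  have q0 : 0 < qabs s by rewrite qabs_gt0.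
  have r0 : 0 <= r by apply: le_trans (str 0).
  (* [G t] is bounded by a power of |s| rather than |t|, whatever the sign of [e]: the increment is
     at most D r |s|^(e-1) <= D |s|^e. *)
  have Gt : `|G t| <= (B + D) * qabs s ^ e.
    rewrite -[G t](subrK (G s)) addrC (le_trans (ler_normD _ _))//.
    rewrite mulrDl lerD ?bG// (le_trans (hG _ _ _ s0 str rs))//.
    rewrite ler_pM2l// expfzDr ?gt_eqF// mulrCA ler_piMr ?exprz_ge0 ?qabs_ge0//.
    rewrite exprN1 ler_pdivrMr// mul1r (le_trans rs)//.
    by rewrite ler_pdivrMr// ler_peMr ?qabs_ge0// ler1n.
  have -> : F t * G t - F s * G s = (F t - F s) * G t + F s * (G t - G s).
    by ring.
  rewrite (le_trans (ler_normD _ _))// !normrM mulrDl lerD//.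
    rewrite (_ : d + e - 1 = (d - 1) + e); last by ring.
    rewrite (expfzDr (d - 1) e) ?gt_eqF//.
    rewrite (_ : C * _ * _ =
      C * (r * qabs s ^ (d - 1)) * ((B + D) * qabs s ^ e)); last by ring.
    by apply: ler_pM => //; exact: hF.
  rewrite (_ : d + e - 1 = d + (e - 1)); last by ring.
  rewrite (expfzDr d (e - 1)) ?gt_eqF//.
  rewrite (_ : A * _ * _ =
    A * qabs s ^ d * (D * (r * qabs s ^ (e - 1)))); last by ring.
  by apply: ler_pM => //; [exact: bF|exact: hG].
- exists C => // s t r s0 str rs.
  by rewrite -!FG ?hF// (perturb_neq0 s0 str rs).
Qed.

(* Curves rather than lines, because |y|^2 is quadratic along Y_j. *)
Lemma hrat_derive d F (v : quat R) : hrat d F ->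
  exists2 G, hrat (d - 1) G &
    forall (gam : R -> quat R) (u a : R), gam u != 0 ->
      (forall i, is_derive u (1:R) (fun x => gam x 0 i) (a * v 0 i)) ->
      is_derive u (1:R) (fun x => F (gam x)) (a * G (gam u)).
Proof.
elim=> {d F} [c|d|i||d F G _ [F' rF' hF] _ [G' rG' hG]|
              d e F G rF [F' rF' hF] rG [G' rG' hG]|d F G _ [F' rF' hF] FG].
- exists (fun=> 0); first exact: hrat_zero.
  by move=> gam u a _ _; rewrite mulr0; exact: is_derive_cst.
- exists (fun=> 0); first exact: hrat_zero.
  by move=> gam u a _ _; rewrite mulr0; exact: is_derive_cst.
- exists (fun=> v 0 i); first by rewrite subrr; exact: hrat_cst.
  by move=> gam u a _; apply.
(* The derivative of |s|^(-2) in the direction v is -2 <v, s> |s|^(-4). *)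
- exists (fun s => -2 * ((\sum_(i < 4) v 0 i * s 0 i)
      * ((qabs s ^+ 2)^-1 * (qabs s ^+ 2)^-1))).
    rewrite (_ : -2 - 1 = 0 + (1 + (-2 + -2)))//.
    apply: hrat_mul; first exact: hrat_cst.
    apply: hrat_mul; last by apply: hrat_mul; exact: hrat_invsq.
    apply: hrat_sum => i; rewrite -[1]add0r.
    by apply: hrat_mul; [exact: hrat_cst|exact: hrat_coord].
  move=> gam u a g0 gamv.
  have dsq : is_derive u (1:R) (fun x => qabs (gam x) ^+ 2)
      (a * (2 * \sum_(i < 4) v 0 i * gam u 0 i)).
    rewrite (_ : (fun x => _) = \sum_(i < 4) (fun x => gam x 0 i) ^+ 2).
      apply: is_derive_eq; rewrite !mulr_sumr; apply: eq_bigr => i _.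
      by rewrite /GRing.scale/= expr1; ring.
    by apply/funext => x; rewrite sqr_qabs fct_sumE; apply: eq_bigr.
  apply: is_derive_eq.
    by apply: is_deriveV; rewrite sqrf_eq0 qabs_eq0.
  rewrite /GRing.scale/=; field; by rewrite qabs_eq0.
- exists (fun s => F' s + G' s); first exact: hrat_add.
  move=> gam u a g0 gamv; rewrite mulrDr.
  by apply: is_deriveD; [exact: hF|exact: hG].
- exists (fun s => F s * G' s + F' s * G s).
    apply: hrat_add.
      by rewrite -addrA; exact: hrat_mul.
    by rewrite addrAC; exact: hrat_mul.
  move=> gam u a g0 gamv.
  apply: is_derive_eq.
    by apply: is_deriveM; [exact: hF|exact: hG].
  by rewrite /GRing.scale/=; ring.
- exists F' => // gam u a g0 gamv.
  (* [F] and [G] agree only off the origin, which the curve avoids near [u]; a derivative depends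
     only on such nearby values. *)
  apply: near_eq_is_derive (hF _ _ _ g0 gamv).
  have := near_curve_neq0 g0 (fun i => @ex_derive _ _ _ _ _ _ _ (gamv i)).
  by apply: filterS => x; exact: FG.
Qed.

End HomogeneousRational.

(** * The function s defining the kernel is homogeneous rational *)

Section Kernel.
Variable R : realType.
Implicit Types (s t : quat R).

Lemma mkquatE (a b c d : R) :
  ((q1 (mkquat a b c d) = a) * (q2 (mkquat a b c d) = b)
  * (q3 (mkquat a b c d) = c) * (q4 (mkquat a b c d) = d))%type.
Proof. by rewrite /q1 /q2 /q3 /q4 !mxE !inordK. Qed.

Lemma mkquat_eta s : mkquat (q1 s) (q2 s) (q3 s) (q4 s) = s.
Proof.
by apply/rowP; case=> [[|[|[|[|]]]]]// lt4; rewrite mxE;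
  congr (s _ _); apply/val_inj; rewrite /= inordK.
Qed.

Lemma is_derive_mkquat_re (b c d x : R) i :
  is_derive x (1 : R) (fun y : R => mkquat y b c d 0 i)
    (1 * (delta_mx 0 0 : quat R) 0 i).
Proof.
rewrite mul1r mxE eqxx/=; under eq_fun do rewrite mxE.
case: i => [[|[|[|[|]]]]]//= _; by [exact: is_derive_id|exact: is_derive_cst].
Qed.

Lemma hrat_qconj i : hrat 1 (fun s => qconj s 0 i).
Proof.
have oppH j : hrat 1 (fun s => - s 0 j).
  apply: (@hrat_eq _ _ (fun s => -1 * s 0 j)) => [|s _]; last by rewrite mulN1r.
  by rewrite -[1]add0r; apply: hrat_mul; [exact: hrat_cst|exact: hrat_coord].
by case: i => [[|[|[|[|]]]]]// lt4; under eq_fun do rewrite mxE/=;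
  [exact: hrat_coord|exact: oppH..].
Qed.

(** Each derivative in x_1 is [hrat_derive] along the line through s parallel to the real axis, and
    lowers the degree by one. *)
Lemma hrat_derive1n (k : nat) d F : hrat d F ->
  hrat (d - k%:Z) (fun s =>
    derive1n k (fun x : R => F (mkquat x (q2 s) (q3 s) (q4 s))) (q1 s)).
Proof.
move=> rF; elim: k => [|k IH].
  by rewrite subr0; under eq_fun do rewrite /= mkquat_eta.
have [G rG hG] := hrat_derive (delta_mx 0 0) IH.
rewrite (_ : d - k.+1%:Z = d - k%:Z - 1); last by lia.
apply: hrat_eq rG _ => s s0; rewrite derive1nS derive1E.
have := hG (fun x => mkquat x (q2 s) (q3 s) (q4 s)) (q1 s) 1.
rewrite mkquat_eta => /(_ s0 (is_derive_mkquat_re _ _ _ _)) dG.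
rewrite -[LHS]mul1r -(derive_val (is_derive := dG)).
(* The imaginary coordinates are constant along the line, so the previous derivative restricted to
   it is a function of x alone. *)
by under eq_fun do rewrite !mkquatE.
Qed.

(** The conjugate over |s|^4 has degree 1 - 4 = -3, and 2(n-1) derivatives bring it to -(2n+1). The
    hypothesis [0 < n] makes [n.-1] a true n - 1. *)
Lemma hrat_szego_s n (cn : R) i : (0 < n)%N ->
  hrat (- (2 * n + 1)%:Z) (fun s => szego_s n cn s 0 i).
Proof.
move=> n0; rewrite (_ : - _ = 0 + (1 + (-2 + -2) - (2 * n.-1)%:Z)); last by lia.
under eq_fun do rewrite mxE.
apply: hrat_mul; first exact: hrat_cst.
apply: (@hrat_derive1n _ _ (fun s => qconj s 0 i / qabs s ^+ 4)).
have -> : (fun s => qconj s 0 i / qabs s ^+ 4) =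
    (fun s => qconj s 0 i * ((qabs s ^+ 2)^-1 * (qabs s ^+ 2)^-1)).
  by apply/funext => s; rewrite -invfM -exprD.
apply: hrat_mul; first exact: hrat_qconj.
by apply: hrat_mul; exact: hrat_invsq.
Qed.

End Kernel.

(** * Heisenberg group algebra, the homogeneous norm and the Siegel coordinate *)

Lemma sum4 (R : realType) (F : 'I_4 -> R) : \sum_(i < 4) F i =
  F (inord 0) + F (inord 1) + F (inord 2) + F (inord 3).
Proof.
rewrite !big_ord_recl big_ord0 addr0 !addrA.
by do ![congr (_ + _)]; congr F; apply/val_inj; rewrite /= inordK.
Qed.

Section HeisenbergGroup.
Variables (R : realType) (n : nat).
Implicit Types (g h u v : heis R n) (y z : 'M[R]_(n.-1, 4)).

Lemma qdotE y z (i : 'I_4) : qdot y z 0 i = \sum_(l < n.-1)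
  let p := row l y in let q := row l z in
  [:: q1 p * q1 q + q2 p * q2 q + q3 p * q3 q + q4 p * q4 q;
      q1 p * q2 q - q2 p * q1 q - q3 p * q4 q + q4 p * q3 q;
      q1 p * q3 q + q2 p * q4 q - q3 p * q1 q - q4 p * q2 q;
      q1 p * q4 q - q2 p * q3 q + q3 p * q2 q - q4 p * q1 q]`_i.
Proof.
rewrite summxE; apply: eq_bigr => l _ /=; rewrite mxE !mkquatE.
by case: i => [[|[|[|[|]]]]]//= _; ring.
Qed.

Lemma qdotDl y y' z : qdot (y + y') z = qdot y z + qdot y' z.
Proof.
apply/rowP => i; rewrite mxE !qdotE -big_split; apply: eq_bigr => l _ /=.
by rewrite /q1 /q2 /q3 /q4 !mxE; case: i => [[|[|[|[|]]]]]//= _; ring.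
Qed.

Lemma qdotDr y z z' : qdot y (z + z') = qdot y z + qdot y z'.
Proof.
apply/rowP => i; rewrite mxE !qdotE -big_split; apply: eq_bigr => l _ /=.
by rewrite /q1 /q2 /q3 /q4 !mxE; case: i => [[|[|[|[|]]]]]//= _; ring.
Qed.

Lemma qdotNl y z : qdot (- y) z = - qdot y z.
Proof.
apply/rowP => i; rewrite mxE !qdotE -sumrN; apply: eq_bigr => l _ /=.
by rewrite /q1 /q2 /q3 /q4 !mxE; case: i => [[|[|[|[|]]]]]//= _; ring.
Qed.

Lemma qdotNr y z : qdot y (- z) = - qdot y z.
Proof.
apply/rowP => i; rewrite mxE !qdotE -sumrN; apply: eq_bigr => l _ /=.
by rewrite /q1 /q2 /q3 /q4 !mxE; case: i => [[|[|[|[|]]]]]//= _; ring.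
Qed.

Lemma qimE (p : quat R) (a : 'I_3) : qim p 0 a = p 0 (lift 0 a).
Proof.
by rewrite mxE; case: a => [[|[|[|]]]]//= lt3; congr (p _ _);
  apply/val_inj; rewrite /= inordK.
Qed.

(** The product of a quaternion with its conjugate is real. *)
Lemma qim_qdotyy y : qim (qdot y y) = 0.
Proof.
apply/rowP => a; rewrite qimE qdotE mxE big1// => l _ /=.
by case: a => [[|[|[|]]]]//= _; ring.
Qed.

Lemma yabs_ge0 y : 0 <= yabs y. Proof. exact: sqrtr_ge0. Qed.

Lemma sqr_yabs y : yabs y ^+ 2 = \sum_(l < n.-1) \sum_(j < 4) y l j ^+ 2.
Proof.
rewrite sqr_sqrtr ?sumr_ge0// => [|l _]; last by rewrite sqr_ge0.
by apply: eq_bigr => l _; rewrite sqr_qabs; apply: eq_bigr => j _; rewrite mxE.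
Qed.

Lemma entry_le_yabs y l j : `|y l j| <= yabs y.
Proof.
rewrite -(ler_pXn2r (n := 2)) ?nnegrE ?yabs_ge0// real_normK ?num_real//.
rewrite sqr_yabs (bigD1 l)//= (bigD1 j)//= -addrA lerDl.
rewrite addr_ge0// ?sumr_ge0// => k _; rewrite ?sumr_ge0// => *;
  exact: sqr_ge0.
Qed.

(** The real part of the quaternionic pairing is the Euclidean inner product, so this is
    polarisation. *)
Lemma sqr_yabsD y z :
  yabs (y + z) ^+ 2 = yabs y ^+ 2 + yabs z ^+ 2 + 2 * qdot y z 0 0.
Proof.
rewrite qdotE !sqr_yabs mulr_sumr -!big_split; apply: eq_bigr => l _ /=.
by rewrite !sum4 /q1 /q2 /q3 /q4 !mxE; ring.
Qed.

(** A crude bound: each of the n - 1 rows contributes four products of entries, and each product is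
    at most |y| |z|. *)
Lemma qdot_le y z i : `|qdot y z 0 i| <= 4 * n%:R * (yabs y * yabs z).
Proof.
rewrite qdotE (le_trans (ler_norm_sum _ _ _))//.
apply: (@le_trans _ _ (\sum_(l < n.-1) 4 * (yabs y * yabs z))).
  apply: ler_sum => l _ /=.
  have H j k : `|y l (inord j) * z l (inord k)| <= yabs y * yabs z.
    by rewrite normrM ler_pM// entry_le_yabs.
  have {}H j k :
      - (yabs y * yabs z) <= y l (inord j) * z l (inord k) <= yabs y * yabs z.
    by have := H j k; rewrite ler_norml.
  rewrite ler_norml; apply/andP; rewrite /q1 /q2 /q3 /q4 !mxE.
  case: i => [[|[|[|[|]]]]]//= _;
   [ have /andP[? ?] := H 0%N 0%N; have /andP[? ?] := H 1%N 1%N;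
     have /andP[? ?] := H 2%N 2%N; have /andP[? ?] := H 3%N 3%N
   | have /andP[? ?] := H 0%N 1%N; have /andP[? ?] := H 1%N 0%N;
     have /andP[? ?] := H 2%N 3%N; have /andP[? ?] := H 3%N 2%N
   | have /andP[? ?] := H 0%N 2%N; have /andP[? ?] := H 1%N 3%N;
     have /andP[? ?] := H 2%N 0%N; have /andP[? ?] := H 3%N 1%N
   | have /andP[? ?] := H 0%N 3%N; have /andP[? ?] := H 1%N 2%N;
     have /andP[? ?] := H 2%N 1%N; have /andP[? ?] := H 3%N 0%N];
   split; lra.
rewrite sumr_const card_ord -[_ *+ _]mulr_natl mulrCA -mulrA ler_wpM2l//.
by rewrite ler_wpM2r ?mulr_ge0 ?yabs_ge0// ler_nat leq_pred.
Qed.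

(** The argument of s in the kernel: [szegoK cn g] is [szego_s cn (siegel g)] by definition. *)
Definition siegel g : quat R := quat_of_re_im (yabs g.2 ^+ 2) g.1.

Lemma siegel_re g : siegel g 0 0 = yabs g.2 ^+ 2.
Proof. by rewrite mxE. Qed.

Lemma siegel_im g (a : 'I_3) : siegel g 0 (lift 0 a) = g.1 0 a.
Proof.
by rewrite mxE; case: a => [[|[|[|]]]]//= lt3; congr (g.1 _ _);
  apply/val_inj; rewrite /= inordK.
Qed.

Lemma hnorm_ge0 g : 0 <= hnorm g. Proof. exact: powR_ge0. Qed.

Lemma qabs_siegel g : qabs (siegel g) = hnorm g ^+ 2.
Proof.
have E : qabs (siegel g) ^+ 2 = yabs g.2 ^+ 4 + \sum_(a < 3) g.1 0 a ^+ 2.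
  rewrite sqr_qabs big_ord_recl siegel_re -exprM; congr (_ + _).
  by apply: eq_bigr => a _; rewrite siegel_im.
rewrite /hnorm -E -powR_mulrn ?powR_ge0// -!powR_mulrn ?qabs_ge0// -!powRrM.
by rewrite (_ : _ * _ = 1) ?powRr1 ?qabs_ge0//; field.
Qed.

Lemma siegel_eq0 g : siegel g = 0 -> g = hzero.
Proof.
case: g => t y s0; congr (_, _).
  by apply/rowP => a; rewrite -[LHS](siegel_im (t, y)) s0 !mxE.
have y0 : yabs y == 0.
  by rewrite -sqrf_eq0 -[X in X == _](siegel_re (t, y)) s0 mxE.
apply/matrixP => l j; rewrite mxE; apply/eqP; rewrite -normr_le0.
by rewrite -(eqP y0) entry_le_yabs.
Qed.

Lemma hnorm_gt0 g : g <> hzero -> 0 < hnorm g.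
Proof.
move=> g0; rewrite lt_def hnorm_ge0 andbT -sqrf_eq0 -qabs_siegel qabs_eq0.
by apply/eqP => /siegel_eq0.
Qed.

Lemma yabs_le_hnorm g : yabs g.2 <= hnorm g.
Proof.
rewrite -(ler_pXn2r (n := 2)) ?nnegrE ?yabs_ge0 ?hnorm_ge0//.
by rewrite -qabs_siegel -siegel_re (le_trans (ler_norm _))// coord_le_qabs.
Qed.

Lemma hnorm_inv g : hnorm (hinv g) = hnorm g.
Proof.
have -> : hnorm (hinv g) =
    (yabs (- g.2) ^+ 4 + \sum_(a < 3) (- g.1) 0 a ^+ 2) `^ (4^-1) by [].
have -> : yabs (- g.2) = yabs g.2.
  congr Num.sqrt; apply: eq_bigr => l _; rewrite !sqr_qabs.
  by apply: eq_bigr => j _; rewrite !mxE sqrrN.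
by congr ((_ + _) `^ _); apply: eq_bigr => a _; rewrite mxE sqrrN.
Qed.

Lemma qimD (p q : quat R) : qim (p + q) = qim p + qim q.
Proof. by apply/rowP => a; rewrite qimE 2!mxE -!qimE. Qed.

Lemma qimN (p : quat R) : qim (- p) = - qim p.
Proof. by apply/rowP => a; rewrite qimE 2!mxE -!qimE. Qed.

(** Inserting a middle point exhibits the change of one kernel argument as multiplication by an
    increment, on the right or on the left. The twists cancel because Im <y, y> = 0. *)
Lemma hmul_mid u v h :
  hmul (hinv h) v = hmul (hmul (hinv h) u) (hmul (hinv u) v).
Proof.
congr (_, _) => /=; last by rewrite addrA addrK.
rewrite qdotDl !qdotDr !qdotNl !qdotNr !(qimD, qimN) qim_qdotyy.
move: (qim _) (qim _) (qim _) => A B C.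
by apply/rowP => a; rewrite !mxE; ring.
Qed.

Lemma hmul0g g : hmul (hinv hzero) g = g.
Proof.
case: g => t y; congr (_, _); rewrite /= !oppr0 ?add0r//.
have -> : qdot 0 y = 0 by rewrite -(subrr y) qdotDl qdotNl subrr.
by rewrite -(subrr (0 : quat R)) qimD qimN subrr scaler0 addr0.
Qed.

Lemma hmul_inv_eq0 g h : hmul (hinv h) g = hzero -> g = h.
Proof.
case: g h => [t y] [t' y'] [/= Et Ey].
have yy' : y = y' by apply/eqP; rewrite -subr_eq0 addrC Ey.
rewrite yy' qdotNl qimN qim_qdotyy oppr0 scaler0 addr0 in Et.
by rewrite yy'; congr (_, _); apply/eqP; rewrite -subr_eq0 addrC Et.
Qed.

Lemma rho_ge0 g h : 0 <= rho g h. Proof. exact: hnorm_ge0. Qed.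

(** Polarisation of [qim_qdotyy] at [y + z]. *)
Lemma qim_qdotC y z : qim (qdot y z) = - qim (qdot z y).
Proof.
apply/eqP; rewrite -subr_eq0 opprK; apply/eqP.
have := qim_qdotyy (y + z); rewrite qdotDl !qdotDr !qimD !qim_qdotyy.
by rewrite add0r addr0.
Qed.

Lemma rho_sym g h : rho g h = rho h g.
Proof.
rewrite /rho -hnorm_inv; congr hnorm; congr (_, _) => /=; last first.
  by rewrite opprD opprK addrC.
rewrite !qdotNl !qimN (qim_qdotC g.2); move: (qim _) => A.
by apply/rowP => a; rewrite !mxE; ring.
Qed.

(** The real coordinate is the polarisation [sqr_yabsD], the imaginary ones are the group law. Both
    carry the same factor 2, so they combine into the full quaternionic pairing. *)
Lemma siegelM u v i : siegel (hmul u v) 0 i =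
  siegel u 0 i + siegel v 0 i + 2 * qdot u.2 v.2 0 i.
Proof.
case: (unliftP 0 i) => [a|] ->; first by rewrite !siegel_im 3!mxE qimE.
by rewrite !siegel_re sqr_yabsD.
Qed.

Lemma siegel_le g i : `|siegel g 0 i| <= hnorm g ^+ 2.
Proof. by rewrite -qabs_siegel coord_le_qabs. Qed.

(** 8n is twice the constant 4n of [qdot_le]; the 1 absorbs the square of the smaller norm into the
    product of the two norms. *)
Let M : R := 8 * n%:R + 1.

Lemma siegelMr_le u v i : hnorm v <= hnorm u ->
  `|siegel (hmul u v) 0 i - siegel u 0 i| <= M * (hnorm u * hnorm v).
Proof.
move=> vu; rewrite siegelM.
rewrite (_ : _ - _ = siegel v 0 i + 2 * qdot u.2 v.2 0 i); last by ring.
rewrite (le_trans (ler_normD _ _))// /M [leRHS]mulrDl mul1r [leLHS]addrC.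
rewrite lerD//; last first.
  by rewrite (le_trans (siegel_le _ _))// expr2 ler_wpM2r ?hnorm_ge0.
rewrite normrM ger0_norm// (_ : 8 = 2 * 4 :> R); last by ring.
rewrite -!mulrA ler_wpM2l// (le_trans (qdot_le _ _ _))// -mulrA !ler_wpM2l//.
by rewrite ler_pM ?yabs_ge0 ?yabs_le_hnorm.
Qed.

Lemma siegelMl_le u v i : hnorm u <= hnorm v ->
  `|siegel (hmul u v) 0 i - siegel v 0 i| <= M * (hnorm u * hnorm v).
Proof.
move=> uv; rewrite siegelM.
rewrite (_ : _ - _ = siegel u 0 i + 2 * qdot u.2 v.2 0 i); last by ring.
rewrite (le_trans (ler_normD _ _))// /M [leRHS]mulrDl mul1r [leLHS]addrC.
rewrite lerD//; last first.
  by rewrite (le_trans (siegel_le _ _))// expr2 ler_wpM2l ?hnorm_ge0.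
rewrite normrM ger0_norm// (_ : 8 = 2 * 4 :> R); last by ring.
rewrite -!mulrA ler_wpM2l// (le_trans (qdot_le _ _ _))// -mulrA !ler_wpM2l//.
by rewrite ler_pM ?yabs_ge0 ?yabs_le_hnorm.
Qed.

End HeisenbergGroup.

(** The constants of a finite family are summed; the extra 1 keeps the result positive for an empty
    family. It passes from coordinates to whole quaternions. *)
Lemma uniform_const (R : realType) (I : finType) (T : Type) (P : T -> Prop)
    (f : I -> T -> R) (B : T -> R) : (forall x, P x -> 0 <= B x) ->
  (forall i, exists2 C, 0 < C & forall x, P x -> f i x <= C * B x) ->
  exists2 C, 0 < C & forall i x, P x -> f i x <= C * B x.
Proof.
move=> B0 /fin_all_exists2[C C0 hC]; exists (1 + \sum_i C i).
  by rewrite ltr_pwDl// sumr_ge0// => i _; exact: ltW.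
move=> i x Px; apply: le_trans (hC i x Px) _; rewrite ler_wpM2r ?B0//.
rewrite (bigD1 i)//= addrCA lerDl addr_ge0// sumr_ge0// => j _; exact: ltW.
Qed.

(** The two difference quotients coincide. This reduces directional derivatives on the group to the
    curves of [hrat_derive]. *)
Lemma is_derive_line (R : realType) (V : normedModType R) (f : V -> R)
    (g v : V) (df : R) :
  is_derive (0 : R) (1 : R) (fun x : R => f (x *: v + g)) df ->
  is_derive g v f df.
Proof.
have E : (fun h : R => h^-1 *: (((fun x : R => f (x *: v + g)) \o
      shift (0 : R)) (h *: (1 : R)) - f ((0 : R) *: v + g))) =
    (fun h : R => h^-1 *: ((f \o shift g) (h *: v) - f g)).
  by apply/funext => h /=; rewrite addr0 scale0r add0r [h *: _]mulr1.
by case=> dl vl; constructor; [move: dl|move: vl]; rewrite /derivable /derive E.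
Qed.

Lemma is_derive_affine (R : realType) (a b x : R) :
  is_derive x (1 : R) (fun y : R => y * a + b) a.
Proof.
rewrite (_ : (fun _ => _) = (id : R -> R) * cst a + cst b)//.
apply: is_derive_eq; rewrite addr0 scaler0 add0r.
exact: mulr1.
Qed.

(** * Size, regularity and horizontal derivatives of the kernel *)

Section KernelEstimates.
Variables (R : realType) (n : nat) (cn : R).
Hypothesis n0 : (0 < n)%N.
Implicit Types (g h u v : heis R n).

Lemma hnorm_pow g (m : nat) :
  (hnorm g ^+ 2) ^ (- m%:Z) = (hnorm g ^+ (2 * m))^-1.
Proof. by rewrite -exprnN exprM. Qed.

(** Since |sigma| = ||g||^2, degree -(2n+1) in sigma becomes -(4n+2) = -Q in the norm. *)
Lemma szegoK_size : exists2 C, 0 < C & forall g, g <> hzero ->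
  qabs (szegoK cn g) <= C * (hnorm g ^+ homdim n)^-1.
Proof.
have [||C C0 hC] := @uniform_const R 'I_4 (heis R n) (fun g => g <> hzero)
    (fun i g => `|szegoK cn g 0 i|) (fun g => (hnorm g ^+ homdim n)^-1).
- by move=> g _; rewrite invr_ge0 exprn_ge0 ?hnorm_ge0.
- move=> i; have [C C0 hC] := hrat_bound (hrat_szego_s cn i n0).
  exists C => // g g0; have := hC (siegel g).
  rewrite -qabs_gt0 qabs_siegel exprn_gt0 ?hnorm_gt0// => /(_ isT).
  by rewrite hnorm_pow (_ : 2 * _ = homdim n)%N// /homdim; lia.
- exists (2 * C) => [|g g0]; first exact: mulr_gt0.
  by rewrite -mulrA qabs_le// => i; exact: hC.
Qed.

(** [hrat_lipschitz] with r = M ||u|| e: the smallness hypothesis says r <= |sigma(u)| / 16, and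
    ||u|| * ||u||^(-(4n+4)) = ||u||^(-(Q+1)). Stating it for an arbitrary [v] covers increments on
    either side. *)
Lemma szegoK_close (M : R) : 0 < M ->
  exists2 C, 0 < C & forall u v (e : R), u <> hzero ->
    (forall i, `|siegel v 0 i - siegel u 0 i| <= M * (hnorm u * e)) ->
    16 * M * e <= hnorm u ->
    qabs (szegoK cn v - szegoK cn u) <= C * (e / hnorm u ^+ (homdim n + 1)).
Proof.
move=> M0.
pose P (x : heis R n * heis R n * R) := [/\ x.1.1 <> hzero,
  (forall i,
    `|siegel x.1.2 0 i - siegel x.1.1 0 i| <= M * (hnorm x.1.1 * x.2)) &
  16 * M * x.2 <= hnorm x.1.1].
have [||C C0 hC] := @uniform_const R 'I_4 _ P
    (fun i x => `|szegoK cn x.1.2 0 i - szegoK cn x.1.1 0 i|)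
    (fun x => x.2 / hnorm x.1.1 ^+ (homdim n + 1)).
- move=> [[u v] e] [/= u0 uv _].
  rewrite mulr_ge0 ?invr_ge0 ?exprn_ge0 ?hnorm_ge0//.
  (* The sign of [e] is read off the coordinate bound, as [M] and the norm of [u] are positive. *)
  have := le_trans (normr_ge0 _) (uv 0).
  by rewrite pmulr_rge0// pmulr_rge0// hnorm_gt0.
- move=> i; have [C C0 hC] := hrat_lipschitz (hrat_szego_s cn i n0).
  exists (C * M) => [|[[u v] e] [/= u0 uv eu]]; first exact: mulr_gt0.
  have N0 := hnorm_gt0 u0.
  apply: le_trans (hC (siegel u) (siegel v) _ _ uv _) _.
  + by rewrite -qabs_gt0 qabs_siegel exprn_gt0.
  + rewrite qabs_siegel ler_pdivlMr// expr2; nra.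
  + rewrite qabs_siegel (_ : - _ - 1 = - (2 * n + 2)%:Z); last by lia.
    rewrite hnorm_pow -mulrA ler_pM2l// -!mulrA ler_pM2l//.
    rewrite (_ : 2 * _ = (homdim n + 1).+1)%N; last by rewrite /homdim; lia.
    by rewrite exprS invfM mulrCA !mulrA mulfK ?gt_eqF// mulrC.
- exists (2 * C) => [|u v e u0 uv eu]; first exact: mulr_gt0.
  rewrite -mulrA qabs_le// => i; rewrite !mxE.
  by have := hC i (u, v, e); rewrite /szegoK !mxE; apply; split.
Qed.

(** Only |y|^2 varies, so the velocity is the fixed real unit direction times a scalar depending on
    the point; that scalar is the [a] of [hrat_derive]. *)
Lemma is_derive_siegel_y g (l : 'I_n.-1) (j i : 'I_4) :
  is_derive (0 : R) (1 : R) (fun x : R => siegel (x *: dir_y R l j + g) 0 i)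
    (2 * g.2 l j * (delta_mx 0 0 : quat R) 0 i).
Proof.
case: (unliftP 0 i) => [a|] ->.
  under eq_fun do rewrite siegel_im /= scaler0 add0r.
  by rewrite mxE /= mulr0; exact: is_derive_cst.
rewrite mxE eqxx/= mulr1.
pose d := delta_mx l j : 'M[R]_(n.-1, 4).
have -> : (fun x : R => siegel (x *: dir_y R l j + g) 0 0) =
   \sum_(k < n.-1) \sum_(m < 4) (fun x : R => x * d k m + g.2 k m) ^+ 2.
  apply/funext => x; rewrite siegel_re sqr_yabs fct_sumE.
  apply: eq_bigr => k _; rewrite fct_sumE; apply: eq_bigr => m _ /=.
  by rewrite 2!mxE.
have dE k m := is_derive_affine (d k m) (g.2 k m) 0.
apply: is_derive_eq.
have dkm k m : d k m = ((k == l) && (m == j))%:R by rewrite mxE.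
rewrite (bigD1 l)//= (bigD1 j)//= !big1 => [|k kl|m mj].
- by rewrite dkm !eqxx mul0r add0r !addr0 /GRing.scale/= mulr1 expr1.
- by rewrite big1// => m _; rewrite dkm (negbTE kl) scaler0.
- by rewrite dkm (negbTE mj) andbF scaler0.
Qed.

Lemma is_derive_siegel_t g (a : 'I_3) (i : 'I_4) :
  is_derive (0 : R) (1 : R) (fun x : R => siegel (x *: dir_t R n a + g) 0 i)
    (1 * (delta_mx 0 (lift 0 a) : quat R) 0 i).
Proof.
case: (unliftP 0 i) => [b|] ->; last first.
  under eq_fun do rewrite siegel_re /= scaler0 add0r.
  by rewrite mxE /= mulr0; exact: is_derive_cst.
rewrite mul1r mxE eqxx/= (inj_eq (@lift_inj _ _)).
under eq_fun do rewrite siegel_im /= 3!mxE eqxx /=.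
exact: is_derive_affine.
Qed.

Lemma Yvf_szegoK (l : 'I_n.-1) (j : 'I_4) (i : 'I_4) :
  exists2 C, 0 < C & forall g, g <> hzero ->
    [/\ derivable (fun h => szegoK cn h 0 i) g (dir_y R l j),
        forall a, derivable (fun h => szegoK cn h 0 i) g (dir_t R n a) &
        `|Yvf l j (fun h => szegoK cn h 0 i) g|
          <= C * (hnorm g ^+ (homdim n + 1))^-1].
Proof.
have rK := hrat_szego_s cn i n0.
have deg : - (2 * n + 1)%:Z - 1 = - (2 * n + 2)%:Z by lia.
have [Gy rGy hGy] := hrat_derive (delta_mx 0 0) rK.
have [Cy Cy0 bGy] := hrat_bound rGy.
have [Gt rGt hGt] := fin_all_exists2
  (fun a : 'I_3 => hrat_derive (delta_mx 0 (lift 0 a)) rK).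
have [Ct Ct0 bGt] : exists2 C, 0 < C & forall a s, s != 0 ->
    `|Gt a s| <= C * qabs s ^ (- (2 * n + 1)%:Z - 1).
  apply: uniform_const => [s _|a]; first by rewrite exprz_ge0 ?qabs_ge0.
  exact: hrat_bound.
(* The derivatives of s have size ||g||^(-(4n+4)); the coefficients of the vector field, linear in
   y, give back one factor ||g||, leaving ||g||^(-(Q+1)). *)
have bound g (C x : R) : g <> hzero ->
   x <= C * qabs (siegel g) ^ (- (2 * n + 1)%:Z - 1) ->
   hnorm g * x <= C * (hnorm g ^+ (homdim n + 1))^-1.
  move=> g0; rewrite qabs_siegel deg hnorm_pow.
  rewrite (_ : 2 * _ = (homdim n + 1).+1)%N; last by rewrite /homdim; lia.
  rewrite -(ler_pM2l (hnorm_gt0 g0)) => /le_trans; apply.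
  by rewrite exprS invfM mulrCA mulVKf// gt_eqF ?hnorm_gt0.
pose B := \sum_(a < 3) \sum_(k < 4) `|bmx R a k j|.
have B0 : 0 <= B by apply: sumr_ge0 => a _; apply: sumr_ge0.
(* The first term is for the y-derivative, with velocity 2 y_lj; the second is for the
   t-derivatives, [B] collecting the entries of the matrices b. *)
exists (2 * Cy + 2 * (B * Ct)) => [|g g0].
  by rewrite ltr_wpDr ?mulr_gt0// !mulr_ge0// ltW.
have s0 : siegel g != 0 by rewrite -qabs_gt0 qabs_siegel exprn_gt0 ?hnorm_gt0.
have dy : is_derive g (dir_y R l j) (fun h => szegoK cn h 0 i)
    (2 * g.2 l j * Gy (siegel g)).
  apply: is_derive_line.
  have := hGy (fun x : R => siegel (x *: dir_y R l j + g)) 0 (2 * g.2 l j).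
  rewrite scale0r add0r; apply => // k; exact: is_derive_siegel_y.
have dt a : is_derive g (dir_t R n a) (fun h => szegoK cn h 0 i)
    (1 * Gt a (siegel g)).
  apply: is_derive_line.
  have := hGt a (fun x : R => siegel (x *: dir_t R n a + g)) 0 1.
  rewrite scale0r add0r; apply => // k; exact: is_derive_siegel_t.
split; [by case: dy|by move=> a; case: (dt a)|].
rewrite /Yvf (derive_val (is_derive := dy)).
under eq_bigr do under eq_bigr do
  rewrite (derive_val (is_derive := dt _)) mul1r.
rewrite (le_trans (ler_normD _ _))// [leRHS]mulrDl lerD//.
  rewrite -mulrA normrM ger0_norm// -mulrA ler_wpM2l// normrM.
  apply: le_trans (bound _ _ _ g0 (bGy _ s0)).
  by rewrite ler_wpM2r// (le_trans (entry_le_yabs _ _ _))// yabs_le_hnorm.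
rewrite normrM ger0_norm// -2!mulrA ler_wpM2l//.
rewrite (le_trans (ler_norm_sum _ _ _))// /B mulr_suml ler_sum// => a _.
rewrite (le_trans (ler_norm_sum _ _ _))// mulr_suml ler_sum// => k _.
rewrite 2!normrM -mulrA ler_wpM2l//.
apply: le_trans (bound _ _ _ g0 (bGt a _ s0)).
by rewrite ler_wpM2r// (le_trans (entry_le_yabs _ _ _))// yabs_le_hnorm.
Qed.

End KernelEstimates.

Theorem theorem1p2 (R : realType) (n : nat) (hn : (2 <= n)%N) (cn : R) :
  (forall (l : 'I_n.-1) (j : 'I_4),
     exists C : R, 0 < C /\
       forall g : heis R n, g <> hzero ->
         YvfH_exists l j (szegoK cn) g /\
         qabs (YvfH l j (szegoK cn) g)
           <= C * (1 / rho g hzero ^+ (homdim n + 1)))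
  /\
  exists c : R, 0 < c /\
    (exists C : R, 0 < C /\
       forall g h : heis R n, g <> h ->
         qabs (szegoK2 cn g h) <= C * (1 / rho g h ^+ homdim n))
    /\
    (exists C : R, 0 < C /\
       forall g g0 h : heis R n, g <> h -> g0 <> h ->
         c * rho g g0 <= rho g0 h ->
         qabs (szegoK2 cn g h - szegoK2 cn g0 h)
           <= C * (rho g g0 / rho g0 h ^+ (homdim n + 1)))
    /\
    (exists C : R, 0 < C /\
       forall g h h0 : heis R n, g <> h -> g <> h0 ->
         c * rho h h0 <= rho g h0 ->
         qabs (szegoK2 cn g h - szegoK2 cn g h0)
           <= C * (rho h h0 / rho g h0 ^+ (homdim n + 1))).
Proof.
have n0 : (0 < n)%N by apply: leq_trans hn.
split => [l j|].
  have [C C0 hC] : exists2 C, 0 < C & forall (i : 'I_4) g, g <> hzero ->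
      `|YvfH l j (szegoK cn) g 0 i| <= C * (hnorm g ^+ (homdim n + 1))^-1.
    apply: uniform_const => [g _|i].
      by rewrite invr_ge0 exprn_ge0 ?hnorm_ge0.
    have [C C0 hC] := Yvf_szegoK cn n0 l j i.
    by exists C => // g g0; rewrite mxE; have [] := hC g g0.
  exists (2 * C); split=> [|g g0]; first exact: mulr_gt0.
  split=> [i|]; last first.
    by rewrite /rho hmul0g div1r -mulrA qabs_le// => i; exact: hC.
  have [_ _ /(_ g g0) [dy dt _]] := Yvf_szegoK cn n0 l j i.
  by split.
set M : R := 8 * n%:R + 1; have M0 : 0 < M by rewrite ltr_wpDl.
have [C C0 hC] := szegoK_close cn n0 M0.
have small (u v : R) :
    0 <= v -> (16 * M + 1) * v <= u -> v <= u /\ 16 * M * v <= u.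
  by move=> v0 H; have Mv := mulr_ge0 (ltW M0) v0; split; lra.
(* The term 16 M gives the smallness required by [szegoK_close]; the 1 makes the increment no larger
   than the base point, as the estimates on [siegel] require. *)
exists (16 * M + 1); split; first by rewrite ltr_wpDl// mulr_ge0// ltW.
split; last split.
- have [D D0 hD] := szegoK_size cn n0.
  exists D; split=> // g h gh; rewrite div1r; apply: hD.
  by move/hmul_inv_eq0.
- exists C; split=> // g g0 h gh g0h /(small _ _ (rho_ge0 _ _)) [vu Mvu].
  (* The base point is h^(-1) g0, and the increment g0^(-1) g multiplies it on the right. *)
  rewrite /szegoK2 (hmul_mid g0); apply: hC => // [/hmul_inv_eq0//|i].
  exact: siegelMr_le.
- exists C; split=> // g h h0 gh gh0 /(small _ _ (rho_ge0 _ _)) [vu Mvu].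
  (* Now the base point is h0^(-1) g and the increment h^(-1) h0 stands on the left; its norm is
     [rho h0 h], whence the use of symmetry. *)
  rewrite /szegoK2 (hmul_mid h0); apply: hC => // [/hmul_inv_eq0//|i].
  rewrite (mulrC (hnorm _)) (rho_sym h).
  by apply: siegelMl_le; rewrite -[hnorm _]/(rho h0 h) rho_sym.
Qed.
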